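(* Let $k$ be a field of characteristic zero, let $J$ be a homogeneous ideal of $k[x_1,\dots,x_n]$ contained in the ideal generated by $x_1,\dots,x_n$, and suppose that $A:=k[x_1,\dots,x_n]/J$ is an Artinian Gorenstein algebra with socle degree $\eta$. Let $\mathrm{e}_1,\dots,\mathrm{e}_n$ be the elements of $A$ represented by $x_1,\dots,x_n$, let $A=\bigoplus_{j\ge0}A_j$ be the grading in which $A_j$ is the subspace of elements represented by forms of degree $j$ (so that $\mathrm{Soc}(A)=A_\eta$), and let $\rho:A\to k$ be a linear form whose kernel is complementary to $\mathrm{Soc}(A)$ and which satisfies $\ker\rho=\bigoplus_{j=0}^{\eta-1}A_j$. Then $$S(x_1,\dots,x_n):=\rho\left((x_1\mathrm{e}_1+\dots+x_n\mathrm{e}_n)^{\eta}\right)$$ is an inverse system for $A$, i.e. $\mathrm{Ann}(S)=J$. In particular, for all integers $n\ge2$, $m\ge3$ and every $Q\in X_n^m$, the associated form $\mathbf{Q}$ is an inverse system for the Milnor algebra $M(Q)$, i.e. $\mathrm{Ann}(\mathbf{Q})=J(Q)$.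
   Context: In the definition of $S$, the power is expanded in $A[x_1,\dots,x_n]$ and $\rho$ is applied to the coefficients. An ideal is homogeneous if it is generated by forms (homogeneous polynomials). For a local Artinian $k$-algebra $A$ with maximal ideal $\mathfrak{m}$ (here $\mathfrak{m}$ is generated by $\mathrm{e}_1,\dots,\mathrm{e}_n$), $\mathrm{Soc}(A)=\{a\in A: a\,\mathfrak{m}=0\}$; $A$ is Gorenstein if $\mathrm{Soc}(A)$ is one-dimensional over $k$; the socle degree $\eta$ is the largest integer with $\mathfrak{m}^{\eta}\neq0$. For a polynomial $g$ in $x_1,\dots,x_n$ over $k$, $\mathrm{Ann}(g):=\{f\in k[x_1,\dots,x_n]: f(\partial/\partial x_1,\dots,\partial/\partial x_n)(g)=0\}$. A polynomial $g$ with $\mathrm{Ann}(g)=J$ is called a (Macaulay) inverse system for $k[x_1,\dots,x_n]/J$. $\mathcal{Q}_n^m$ is the complex vector space of forms of degree $m$ on $\mathbb{C}^n$. The discriminant $\Delta$ satisfies: for a form $Q$ of degree at least $2$, $\Delta(Q)\neq 0$ if and only if the first-order partial derivatives $Q_j:=\partial Q/\partial z_j$, $j=1,\dots,n$, have no common zero in $\mathbb{C}^n\setminus\{0\}$. For $m\ge 3$, $X_n^m:=\{Q\in\mathcal{Q}_n^m:\Delta(Q)\ne 0\}$. For $Q\in X_n^m$ let $M(Q):=\mathbb{C}[z_1,\dots,z_n]/J(Q)$, where $J(Q)$ is the ideal generated by $Q_1,\dots,Q_n$ (the Milnor algebra). It is a local Artinian Gorenstein algebra; with $\mathfrak{m}$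 its maximal ideal, $\mathrm{Soc}(M(Q))$ is one-dimensional, equals $\mathfrak{m}^{n(m-2)}$, and is spanned by the element $e_0$ represented by the Hessian determinant $\mathrm{Hess}(Q)=\det(\partial^2Q/\partial z_i\partial z_j)$. Let $\omega:\mathrm{Soc}(M(Q))\to\mathbb{C}$ be the linear isomorphism with $\omega(e_0)=1$, and let $e_j$ be the element of $M(Q)$ represented by $z_j$. The associated form of $Q$ is $\mathbf{Q}\in\mathcal{Q}_n^{n(m-2)}$, $\mathbf{Q}(z):=\omega\left((z_1e_1+\dots+z_ne_n)^{n(m-2)}\right)$. *)

(* Defs.v *)
From HB Require Import structures.
From mathcomp Require Import all_boot all_order all_algebra.
From mathcomp Require Import ring_quotient.
From mathcomp Require Import boolp classical_sets functions reals.
From mathcomp Require Import mpoly complex.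

Set Implicit Arguments.
Unset Strict Implicit.
Unset Printing Implicit Defensive.

Import GRing.Theory.
Local Open Scope classical_set_scope.
Local Open Scope ring_scope.
Local Open Scope quotient_scope.

Section Ideals.
Variable R : comNzRingType.
Implicit Types (G I K : set R) (x : R).

Definition is_ideal I :=
  [/\ I 0, (forall x y, I x -> I y -> I (x + y)) &
      (forall a x, I x -> I (a * x))].

Definition gen_ideal G : set R :=
  [set x | exists r (a g : 'I_r -> R),
     (forall i, G (g i)) /\ x = \sum_i a i * g i].

Definition mul_ideal I K : set R :=
  gen_ideal [set x | exists a b, [/\ I a, K b & x = a * b]].

Fixpoint exp_ideal I (d : nat) : set R :=
  if d is d'.+1 then mul_ideal I (exp_ideal I d') else setT.

Definition artinian :=
  forall I : nat -> set R,
    (forall j, is_ideal (I j)) -> (forall j, I j.+1 `<=` I j) ->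
    exists N, forall j, (N <= j)%N -> I j = I N.

Lemma gen_ideal_idealr G : ~ gen_ideal G 1 ->
  idealr_closed [pred x : R | `[< gen_ideal G x >]].
Proof.
move=> G1; split.
- by apply/asboolP; exists 0%N, (fun=> 0), (fun=> 0); split=> [[]//|];
    rewrite big_ord0.
- by apply/negP => /asboolP.
move=> c x y /asboolP[r [a [g [Gg ->]]]] /asboolP[s [b [h [Gh ->]]]].
apply/asboolP; exists (r + s)%N.
exists (fun i : 'I_(r + s) => match fintype.split i with inl j => c * a j | inr j => b j end).
exists (fun i : 'I_(r + s) => match fintype.split i with inl j => g j | inr j => h j end).
split=> [i|]; first by case: (fintype.split i).
rewrite big_split_ord /= mulr_sumr; congr (_ + _); apply: eq_bigr => i _.
  by rewrite (unsplitK (inl i)) mulrA.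
by rewrite (unsplitK (inr i)).
Qed.

Definition gen_idealr G (G1 : ~ gen_ideal G 1) : idealr R :=
  HB.pack_for (idealr R) (fun x : R => `[< gen_ideal G x >])
    (isIdealr.Build R (fun x : R => `[< gen_ideal G x >]) (gen_ideal_idealr G1)).

End Ideals.

Section QuotientAlgebra.
Variables (k : fieldType) (n : nat) (J : idealr {mpoly k[n]}).
Local Notation A := {ideal_quot J}.

Definition quot_scale (c : k) (a : A) : A := \pi_A c%:MP * a.

Fact quot_scaleA c d a : quot_scale c (quot_scale d a) = quot_scale (c * d) a.
Proof. by rewrite /quot_scale mulrA mpolyCM rmorphM. Qed.

Fact quot_scale1 : left_id 1 quot_scale.
Proof. by move=> a; rewrite /quot_scale rmorph1 mul1r. Qed.

Fact quot_scaleDr : right_distributive quot_scale +%R.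
Proof. by move=> c a b; rewrite /quot_scale mulrDr. Qed.

Fact quot_scaleDl a : {morph quot_scale^~ a : c d / c + d}.
Proof. by move=> c d; rewrite /quot_scale mpolyCD rmorphD mulrDl. Qed.

HB.instance Definition _ := GRing.Zmodule_isLmodule.Build k A
  quot_scaleA quot_scale1 quot_scaleDr quot_scaleDl.

Fact quot_scaleAl (c : k) (a b : A) : c *: (a * b) = (c *: a) * b.
Proof. exact: mulrA. Qed.

HB.instance Definition _ := GRing.Lmodule_isLalgebra.Build k A quot_scaleAl.
HB.instance Definition _ := GRing.Lalgebra_isComAlgebra.Build k A.

End QuotientAlgebra.

Section InverseSystem.
Variables (k : fieldType) (n : nat).
Implicit Types (f g : {mpoly k[n]}) (J : idealr {mpoly k[n]}).

Definition homogeneous_ideal (I : set {mpoly k[n]}) :=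
  exists2 G : set {mpoly k[n]},
    (forall g, G g -> exists d, g \is d.-homog) & I = gen_ideal G.

(* f(d/dx_1, ..., d/dx_n) applied to g *)
Definition diff_action f g : {mpoly k[n]} :=
  \sum_(a <- msupp f) f@_a *: g^`M[a].

Definition Ann g : set {mpoly k[n]} := [set f | diff_action f g = 0].

Definition inverse_system J g := Ann g = [set` J].

Section Quotient.
Variable J : idealr {mpoly k[n]}.
Local Notation A := {ideal_quot J}.

Definition var_class (i : 'I_n) : A := \pi_A 'X_i.

Definition max_ideal : set A := gen_ideal (range var_class).

Definition socle : set A := [set a | forall b, max_ideal b -> a * b = 0].

Definition gorenstein :=
  exists2 s : A, s != 0 & socle = [set a | exists c : k, a = c *: s].

Definition socle_degree (eta : nat) :=
  exp_ideal max_ideal eta <> [set 0] /\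
  forall j, exp_ideal max_ideal j <> [set 0] -> (j <= eta)%N.

Definition graded_piece (j : nat) : set A :=
  [set a | exists2 f : {mpoly k[n]}, f \is j.-homog & a = \pi_A f].

Definition sum_pieces (d : nat) : set A :=
  [set a | exists2 g : 'I_d -> A,
     (forall j : 'I_d, graded_piece j (g j)) & a = \sum_j g j].

Definition complementary (U V : set A) :=
  U `&` V = [set 0] /\ forall a, exists u v, [/\ U u, V v & a = u + v].

(* (x_1 e_1 + ... + x_n e_n)^d, expanded in A[x_1, ..., x_n], with w applied
   to the coefficients *)
Definition power_form (w : A -> k) (d : nat) : {mpoly k[n]} :=
  map_mpoly w ((\sum_(i < n) var_class i *: 'X_i : {mpoly A[n]}) ^+ d).

(* w restricts to a linear isomorphism Soc(A) -> k; its values outside Soc(A)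
   are irrelevant *)
Definition socle_iso (w : A -> k) :=
  (forall (c : k) a b, socle a -> socle b -> w (c *: a + b) = c * w a + w b) /\
  set_bij socle [set: k] w.

End Quotient.
End InverseSystem.

Arguments var_class {k n} J i.
Arguments max_ideal {k n} J.
Arguments socle {k n} J.
Arguments graded_piece {k n} J j.
Arguments sum_pieces {k n} J d.
Arguments socle_iso {k n} J w.
Arguments power_form {k n} J w d.

Section MilnorAlgebra.
Variables (k : fieldType) (n m : nat).
Implicit Types Q : {mpoly k[n]}.

(* The property characterising the discriminant of forms of degree m >= 2 in
   n variables *)
Definition is_discriminant (Delta : {mpoly k[n]} -> k) :=
  forall Q, Q \is m.-homog ->
    (Delta Q != 0 <->
     ~ exists2 z : 'I_n -> k, (exists i, z i != 0) &
         forall j, Q^`M(j).@[z] = 0).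

Definition nondegenerate_form (Delta : {mpoly k[n]} -> k) : set {mpoly k[n]} :=
  [set Q | Q \is m.-homog /\ Delta Q != 0].

Definition gradient_ideal Q : set {mpoly k[n]} :=
  gen_ideal (range (fun j : 'I_n => Q^`M(j))).

Lemma gradient_ideal_proper Q :
  (2 < m)%N -> Q \is m.-homog -> ~ gradient_ideal Q 1.
Proof.
move=> m2 Qm [r [a [g [Gg]]]] /(congr1 (mcoeff 0%MM)).
rewrite mcoeff1 eqxx raddf_sum /= big1 => [/eqP|i _]; first by rewrite oner_eq0.
have [j _ <-] := Gg i.
rewrite mcoeffM big1 // => -[u v] /= /eqP/esym/eqP.
rewrite mnmD_eq0 => /andP[_ /eqP ->].
rewrite mcoeff_deriv add0m (dhomog_nemf_coeff Qm) ?mul0rn ?mulr0 //=.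
by rewrite mdeg1; apply: contraTneq m2 => <-.
Qed.

Definition milnor_ideal Q (m2 : (2 < m)%N) (Qm : Q \is m.-homog) :
    idealr {mpoly k[n]} :=
  gen_idealr (gradient_ideal_proper m2 Qm).

Definition hessian Q : {mpoly k[n]} := \det (\matrix_(i, j) Q^`M(i)^`M(j)).

End MilnorAlgebra.

(* Main.v *)
(* Write e^a for the class of x^a in A. The coefficient of x^a in S is
   (eta!/a!) rho(e^a) when |a| = eta and 0 otherwise, so for every polynomial f
   and exponent b the coefficient of x^b in f(d/dx)(S), multiplied by b!, is
   eta! rho(f(e) e^b). Hence f is in Ann(S) iff rho vanishes on the ideal f(e)A.
   A nonzero ideal of A contains a nonzero socle element, on which rho does not
   vanish; so Ann(S) = J.

   For the Milnor algebra, Cramer's rule and Euler's identity put Hess(Q) in the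
   socle. As omega is injective on the socle and omega(Hess(Q)) = 1, the socle is
   the line spanned by Hess(Q), which has degree n(m-2). The Nullstellensatz
   makes all monomials of large degree vanish in M(Q); a nonzero element of
   degree larger than n(m-2) would then have a nonzero multiple in the socle of
   degree larger than n(m-2). So the socle is the top graded piece, and the first
   argument applies to omega composed with the projection onto that piece.

   The Nullstellensatz is proved for uncountable algebraically closed K. If M is
   maximal among the ideals that contain no power of x, and no x_j - c is in M,
   then for each c some g_c (x_j - c) equals a power of x modulo M. Uncountability
   yields infinitely many c with the same power of x and g_c of bounded degree,
   hence a linear relation between the g_c, which becomes a nonzero polynomial in
   x_j that belongs to M; its linear factors contradict the primality of M. *)
From HB Require Import structures.
Require Import Defs.
From mathcomp Require Import all_boot all_order all_algebra.
From mathcomp Require Import ring_quotient.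
From mathcomp Require Import boolp classical_sets functions reals.
From mathcomp Require Import mpoly complex zify.

Import Order.TTheory GRing.Theory Num.Theory.
Local Open Scope classical_set_scope.
Local Open Scope ring_scope.
Local Open Scope quotient_scope.

Set Implicit Arguments.
Unset Strict Implicit.
Unset Printing Implicit Defensive.

(** * Multi-index factorials and powers of linear forms *)

Lemma mnm1_le_mdegS n (a : 'X_{1..n}) d :
  mdeg a = d.+1 -> exists i, (U_(i) <= a)%MM.
Proof.
move=> ad; have /existsP[i ai] : [exists i, a i != 0%N].
  rewrite -negb_forall; apply: contra_eqN ad => /forallP a0.
  by rewrite mdegE big1 // => i _; apply/eqP.
by exists i; rewrite lep1mP.
Qed.

Section PowersOfLinearForms.
Variables (n : nat) (A : comNzRingType).

Definition mfact (a : 'X_{1..n}) : nat := \prod_i (a i)`!.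

(** The falling factorials are the factors that the [a]-th derivative puts on the monomial of
    exponent [a + b]. *)
Lemma mfactD (a b : 'X_{1..n}) :
  mfact (a + b) = (\prod_i (a + b)%MM i ^_ a i * mfact b)%N.
Proof.
rewrite /mfact -big_split; apply: eq_bigr => i _ /=.
by rewrite mnmDE -(ffact_fact (leq_addr (b i) (a i))) addKn.
Qed.

Lemma mfactDU (b : 'X_{1..n}) i : mfact (U_(i) + b) = ((b i).+1 * mfact b)%N.
Proof.
rewrite mfactD (bigD1 i) //= big1 => [|j ji]; rewrite !mnmDE !mnm1E.
  by rewrite eqxx ffactn1 muln1 add1n.
by rewrite eq_sym (negbTE ji) ffactn0.
Qed.

Lemma mderivXn i (p : {mpoly A[n]}) d :
  (p ^+ d.+1)^`M(i) = (p ^+ d * p^`M(i)) *+ d.+1.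
Proof.
elim: d => [|d IHd]; first by rewrite expr0 mul1r.
by rewrite exprS mderivM IHd mulrnAr mulrA -exprS [_^`M(i) * _]mulrC -mulrS.
Qed.

(** The multinomial theorem with denominators cleared. The induction on [d] differentiates in a
    variable occurring in [a], which lowers the power by one. *)
Lemma mcoeff_linear_formXn (e : 'I_n -> A) d a :
  ((\sum_i e i *: 'X_i) ^+ d)@_a *+ mfact a =
    (mmap1 e a *+ d`!) *+ (mdeg a == d).
Proof.
elim: d a => [|d IHd] a.
  rewrite expr0 mcoeff1 mdeg_eq0; case: eqP => [->|_]; last by rewrite mul0rn.
  by rewrite mmap11 /mfact big1 // => i _; rewrite mnm0E.
case ad: (mdeg a) => [|c].
  have /eqP -> : a == 0%MM by rewrite -mdeg_eq0 ad.
  rewrite mulr0n exprS mcoeffM big1 ?mul0rn // => -[u v] /= /eqP/esym/eqP.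
  rewrite mnmD_eq0 => /andP[/eqP -> _].
  rewrite raddf_sum /= big1 ?mul0r // => i _.
  by rewrite mcoeffZ mcoeffX mnm1_eq0 mulr0.
have [i ai] := mnm1_le_mdegS ad; rewrite -ad {c ad}.
rewrite -(submK ai) addmC; set b := (a - _)%MM.
rewrite mfactDU mulrnA [(U_(i) + b)%MM]addmC -mcoeff_deriv mderivXn.
have -> : (\sum_i e i *: 'X_i : {mpoly A[n]})^`M(i) = (e i)%:MP.
  rewrite raddf_sum (bigD1 i) //= big1 => [|j ji].
    rewrite mderivZ mderivX mnm1E eqxx scale1r addr0.
    by rewrite -{1}[U_(i)%MM]add0m addmK mpolyX0 alg_mpolyC.
  by rewrite mderivZ mderivX mnm1E (negbTE ji) scale0r scaler0.
rewrite mcoeffMn mulrC mcoeffCM -mulrnA mulnC mulrnA -mulrnAr IHd.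
rewrite mdegD mdeg1 addn1 eqSS commr_mmap1_M; last by move=> *; apply: mulrC.
rewrite mmap1U factS !mulrnAr mulrC.
by rewrite -!mulrnA; congr (_ *+ _); rewrite mulnCA mulnC [(d`! * _)%N]mulnC.
Qed.

End PowersOfLinearForms.

(** * Inverse systems and quotients of polynomial rings *)

Section Quotient.
Variables (k : fieldType) (n : nat) (J : idealr {mpoly k[n]}).
Local Notation A := {ideal_quot J}.
Local Notation cl := (\pi_A : {mpoly k[n]} -> A).

Lemma pi_eq0 f : (cl f == 0) = (f \in J).
Proof. by rewrite -[f in RHS]subr0 Quotient.idealrBE rmorph0. Qed.

Lemma pi_scale (c : k) f : cl (c *: f) = c *: cl f.
Proof. by rewrite -mul_mpolyC rmorphM. Qed.

Lemma pi_mpolyX a : cl 'X_[a] = mmap1 (var_class J) a.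
Proof.
by rewrite mpolyXE_id rmorph_prod; apply: eq_bigr => i _; rewrite rmorphXn.
Qed.

Lemma mem_socle f :
  socle J (cl f) <-> forall i, f * 'X_i \in J.
Proof.
split=> [sf i | sf b [r [a [g [Gg ->]]]]].
  rewrite -pi_eq0 rmorphM; apply/eqP/sf.
  exists 1%N, (fun=> 1), (fun=> var_class J i).
  by split=> [_|]; [exists i | rewrite big_ord1 mul1r].
rewrite mulr_sumr big1 // => l _; have [i _ <-] := Gg l.
by move: (sf i); rewrite -pi_eq0 rmorphM mulrCA => /eqP->; rewrite mulr0.
Qed.

(** [w] need not be additive: [map_mpoly] sums over the support, and [w 0 = 0] covers the monomials
    outside it. *)
Lemma mcoeff_power_form (w : A -> k) d a : w 0 = 0 ->
  (power_form J w d)@_a = w (((\sum_i var_class J i *: 'X_i) ^+ d)@_a).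
Proof.
move=> w0; rewrite /power_form /map_mpoly /mmap raddf_sum /=.
set p := _ ^+ d.
under eq_bigr => m _ do rewrite mcoeffCM mmap1_id mcoeffX.
have [ap | ap] := boolP (a \in msupp p).
  rewrite (bigD1_seq a) ?msupp_uniq //= eqxx mulr1 big1 ?addr0 // => m ma.
  by rewrite (negbTE ma) mulr0.
rewrite (memN_msupp_eq0 ap) w0 big_seq big1 // => m mp.
by rewrite (negbTE (memPn ap m mp)) mulr0.
Qed.

(** Take the least degree in which every monomial multiplies [f] into [J]. It is positive since [f]
    is not in [J], and a suitable monomial of degree one less works. *)
Lemma mulX_mem_socle N f : (forall a, (N <= mdeg a)%N -> 'X_[a] \in J) ->
  f \notin J -> exists2 a, f * 'X_[a] \notin J & socle J (cl (f * 'X_[a])).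
Proof.
move=> XJ fJ.
have exd : exists d, `[< forall a, mdeg a = d -> f * 'X_[a] \in J >].
  by exists N; apply/asboolP => a aN; apply: idealMr; apply: XJ; rewrite aN.
case: (ex_minnP exd) => -[|d] /asboolP dJ dmin.
  by move: fJ; rewrite -[f]mulr1 -mpolyX0 dJ // mdeg0.
have /asboolPn/existsNP[a /not_implyP[ad /negP faJ]] :
    ~~ `[< forall a, mdeg a = d -> f * 'X_[a] \in J >].
  by apply/negP => /dmin; rewrite ltnn.
exists a => //; apply/mem_socle => i.
by rewrite -mulrA -mpolyXD dJ // mdegD mdeg1 ad addn1.
Qed.

(** Both halves of the theorem reduce to this. The vanishing of monomials above [eta] is a
    hypothesis because it comes from the socle degree in one half and from the Hessian in the
    other. *)
Lemma inverse_system_power_form (rho : {scalar A}) eta :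
  [pchar k] =i pred0 ->
  (forall f j, (j < eta)%N -> f \is j.-homog -> rho (cl f) = 0) ->
  (forall a, (eta < mdeg a)%N -> 'X_[a] \in J) ->
  (forall a, socle J a -> rho a = 0 -> a = 0) ->
  inverse_system J (power_form J rho eta).
Proof.
move=> k0 rho0 XJ rho_inj; set S := power_form J rho eta.
have SE a : S@_a *+ mfact a = rho (cl 'X_[a]) *+ eta`!.
  rewrite mcoeff_power_form ?raddf0 // -raddfMn mcoeff_linear_formXn pi_mpolyX.
  have [a_eta|a_eta|_] := ltngtP (mdeg a) eta; last by rewrite !raddfMn.
    by rewrite raddf0 -pi_mpolyX (rho0 _ _ a_eta) ?mul0rn // dhomogX.
  rewrite -pi_mpolyX; move: (XJ _ a_eta); rewrite -pi_eq0 => /eqP->.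
  by rewrite !raddf0 mul0rn.
have fSE f b :
    (diff_action f S)@_b *+ mfact b = rho (cl (f * 'X_[b])) *+ eta`!.
  rewrite /diff_action [f in RHS]mpolyE mulr_suml !raddf_sum /= -!sumrMnl.
  apply: eq_bigr => a _.
  rewrite mcoeffZ mcoeff_mderivm -mulrnAr -mulrnA -mfactD SE.
  by rewrite -scalerAl -mpolyXD (pi_scale f@_a) linearZ /= mulrnAr.
(* Characteristic zero allows the factorials to be cancelled. *)
have natr0 p d : (0 < d)%N -> (p : k) *+ d = 0 -> p = 0.
  move=> d0 /eqP; rewrite -mulr_natr mulf_eq0 ((pcharf0P k).1 k0).
  by rewrite (gtn_eqF d0) orbF => /eqP.
apply/predeqP => f; split=> [fS | fJ].
  apply/negPn/negP => /= fJ.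
  have [a faJ fa_soc] := mulX_mem_socle XJ fJ.
  move/negP: faJ; apply; rewrite -pi_eq0; apply/eqP/rho_inj => //.
  by apply: (natr0 _ eta`! (fact_gt0 _)); rewrite -fSE fS mcoeff0 mul0rn.
apply/mpolyP => b; rewrite mcoeff0; apply: (natr0 _ (mfact b)).
  by apply: prodn_gt0 => i; apply: fact_gt0.
rewrite fSE rmorphM; move: fJ; rewrite /= -pi_eq0 => /eqP->.
by rewrite mul0r raddf0 mul0rn.
Qed.

(** Above the socle degree these powers are zero, so the monomials of larger degree lie in [J]. *)
Lemma exp_max_ideal_mpolyX a : exp_ideal (max_ideal J) (mdeg a) (cl 'X_[a]).
Proof.
move ad: (mdeg a) => d; elim: d => [//|d IHd] in a ad *.
have [i ai] := mnm1_le_mdegS ad.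
move: ad; rewrite -(submK ai); set b := (a - _)%MM.
rewrite mdegD mdeg1 addn1 => -[bd].
exists 1%N, (fun=> 1), (fun=> var_class J i * cl 'X_[b]); split=> [_|].
  exists (var_class J i), (cl 'X_[b]); split=> //; last exact: IHd.
  exists 1%N, (fun=> 1), (fun=> var_class J i).
  by split=> [_|]; [exists i | rewrite big_ord1 mul1r].
by rewrite big_ord1 mul1r mulrC mpolyXD rmorphM.
Qed.

Lemma sum_pieces_homog d f j :
  (j < d)%N -> f \is j.-homog -> sum_pieces J d (cl f).
Proof.
move=> jd fj; pose j' := Ordinal jd.
exists (fun i => if i == j' then cl f else 0) => [i|].
  case: eqP => [->|_]; first by exists f.
  by exists 0; rewrite ?dhomog0 ?rmorph0.
by rewrite -big_mkcond big_pred1_eq.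
Qed.

Lemma inverse_system_socle_degree (rho : {scalar A}) eta :
  [pchar k] =i pred0 ->
  socle_degree J eta ->
  complementary [set a | rho a = 0] (socle J) ->
  [set a | rho a = 0] = sum_pieces J eta ->
  inverse_system J (power_form J rho eta).
Proof.
move=> k0 [_ eta_max] [ker_soc _] kerE.
apply: inverse_system_power_form => // [f j j_eta fj | a a_eta | a soc_a rho_a].
- have : [set a | rho a = 0] (cl f).
    by rewrite kerE; apply: sum_pieces_homog fj.
  by [].
- have max0 : exp_ideal (max_ideal J) (mdeg a) = [set 0].
    by apply: contrapT => /eta_max; rewrite leqNgt a_eta.
  by have := exp_max_ideal_mpolyX a; rewrite max0 => /eqP; rewrite pi_eq0.
by have : ([set a | rho a = 0] `&` socle J) a by []; rewrite ker_soc.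
Qed.

End Quotient.

(** * Homogeneous ideals, Euler's identity and the Hessian *)

Section Homogeneous.
Variables (k : fieldType) (n : nat).
Implicit Types (p Q : {mpoly k[n]}).

Lemma dhomog_mderiv p d i : p \is d.-homog -> p^`M(i) \is d.-1.-homog.
Proof.
move=> /dhomogP pd; apply/dhomogP => a; rewrite mcoeff_msupp mcoeff_mderiv.
move=> pa; have /pd : (a + U_(i))%MM \in msupp p.
  by rewrite mcoeff_msupp; apply: contraNneq pa => ->; rewrite mul0rn.
by rewrite /= mdegD mdeg1 addn1 => <-.
Qed.

Lemma euler_identity p d :
  p \is d.-homog -> \sum_(i < n) p^`M(i) * 'X_i = p *+ d.
Proof.
move=> /dhomogP pd.
under eq_bigr => i _ do rewrite [p in p^`M(_)]mpolyE raddf_sum mulr_suml.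
rewrite exchange_big [p in RHS]mpolyE -sumrMnl /= !big_seq.
apply: eq_bigr => a /pd /= <-; rewrite mdegE -sumrMnr; apply: eq_bigr => i _.
rewrite mderivZ mderivX scalerA -scalerAl -mpolyXD.
(* If the variable does not occur in [a], the truncated difference [a - U_(i)] is meaningless, but
   its coefficient is zero. *)
have [->|ai] := eqVneq (a i) 0%N; first by rewrite mulr0 scale0r mulr0n.
by rewrite submK ?lep1mP // mulr_natr scalerMnl.
Qed.

Lemma dhomog_det d l (B : 'M[{mpoly k[n]}]_l) :
  (forall i j, B i j \is d.-homog) -> \det B \is (l * d).-homog.
Proof.
move=> Bd; apply: rpred_sum => s _; rewrite rpredMsign.
rewrite -[l in (l * d)%N]card_ord -sum_nat_const.
by elim/big_ind2: _ => [|p a q b pa qb|i _]; [apply: dhomog1|rewrite dhomogM|].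
Qed.

(** Write [f] as a combination of homogeneous generators with monomial terms as coefficients; the
    projection keeps or kills each summand. *)
Lemma homogeneous_ideal_pihomog (J : idealr {mpoly k[n]}) d f :
  homogeneous_ideal [set` J] -> f \in J -> pihomog mdeg d f \in J.
Proof.
move=> [G Ghom JG] fJ; have : [set` J] f by [].
rewrite JG => -[r [a [g [Gg ->]]]]; rewrite raddf_sum rpred_sum //= => i _.
have gJ : g i \in J.
  have : gen_ideal G (g i); last by rewrite -JG.
  by exists 1%N, (fun=> 1), (fun=> g i); rewrite big_ord1 mul1r.
have [e ge] := Ghom _ (Gg i).
rewrite [a i]mpolyE mulr_suml raddf_sum rpred_sum //= => b _.
have bge : (a i)@_b *: 'X_[b] * g i \is (mdeg b + e).-homog.
  by rewrite dhomogM // dhomogZ // dhomogX.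
have [<-|bed] := eqVneq (mdeg b + e)%N d; first by rewrite pihomog_dE // idealMr.
by rewrite (pihomog_ne0 bed) // idealr0.
Qed.

(** By Euler's identity for the partial derivatives, the Hessian matrix sends the vector of
    variables to [m] times the gradient. Multiply by the adjugate. *)
Lemma hessian_mulX m Q j : Q \is m.+1.-homog ->
  hessian Q * 'X_j =
    (\sum_i (\adj (\matrix_(i, j) Q^`M(i)^`M(j))) j i * Q^`M(i)) *+ m.
Proof.
move=> Qm; rewrite /hessian; set H := \matrix_(_, _) _.
pose x : 'cV_n := \col_i ('X_i : {mpoly k[n]}).
have Hx : H *m x = \col_i (Q^`M(i) *+ m).
  apply/colP => i; rewrite !mxE -(euler_identity (dhomog_mderiv i Qm)).
  by apply: eq_bigr => l _; rewrite !mxE.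
have : (\adj H *m (H *m x)) j 0 = ((\det H)%:M *m x) j 0
  by rewrite mulmxA mul_adj_mx.
rewrite Hx mul_scalar_mx !mxE => <-; rewrite -sumrMnl; apply: eq_bigr => i _.
by rewrite !mxE mulrnAr.
Qed.

Lemma dhomog_hessian m Q :
  Q \is m.-homog -> hessian Q \is (n * (m - 2)).-homog.
Proof.
move=> Qm; apply: dhomog_det => i j; rewrite mxE subn2.
by do 2!apply: dhomog_mderiv.
Qed.

(** Pigeonhole: in large degree some exponent reaches its bound [N i]. *)
Lemma mpolyX_mem_idealr (J : idealr {mpoly k[n]}) :
  (forall i, exists N, 'X_i ^+ N \in J) ->
  exists N, forall a, (N <= mdeg a)%N -> 'X_[a] \in J.
Proof.
move=> /choice[N NJ]; exists (\sum_i N i).+1 => a Na.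
have /existsP[i Nai] : [exists i, N i <= a i]%N.
  rewrite -[[exists _, _]]negbK negb_exists; apply: contraL Na => /forallP aN.
  by rewrite -ltnNge ltnS mdegE leq_sum // => i _; rewrite ltnW // ltnNge.
have /submK <- : (U_(i) *+ N i <= a)%MM.
  apply/mnm_lepP => j; rewrite mulmnE mnm1E.
  by case: eqP => [<-|_]; rewrite ?mul1n ?mul0n.
by rewrite mpolyXD -mpolyXn idealMr.
Qed.

End Homogeneous.

(** * From a socle isomorphism to an inverse system *)

Section SocleForm.
Variables (k : fieldType) (n : nat) (J : idealr {mpoly k[n]}).
Local Notation A := {ideal_quot J}.
Local Notation cl := (\pi_A : {mpoly k[n]} -> A).

Lemma inverse_system_socle_iso (w : A -> k) (h : {mpoly k[n]}) eta :
  [pchar k] =i pred0 ->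
  homogeneous_ideal [set` J] ->
  (forall i, exists N, 'X_i ^+ N \in J) ->
  socle_iso J w ->
  h \is eta.-homog -> socle J (cl h) -> w (cl h) = 1 ->
  inverse_system J (power_form J w eta).
Proof.
move=> k0 Jhom /mpolyX_mem_idealr[N JN] [wlin [_ winj _]] h_eta soc_h wh.
have soc0 : socle J 0 by move=> b _; rewrite mul0r.
have w0 : w 0 = 0.
  have := wlin 1 _ _ soc0 soc0; rewrite scaler0 addr0 mul1r.
  by rewrite -[X in X = _]addr0 => /addrI.
have soc_hZ c : socle J (c *: cl h).
  by move=> b Jb; rewrite -scalerAl soc_h // scaler0.
have whZ c : w (c *: cl h) = c.
  by rewrite -[X in w X]addr0 wlin // wh w0 mulr1 addr0.
have socE a : socle J a -> a = w a *: cl h.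
  by move=> soc_a; apply: winj; rewrite ?inE // whZ.
have JX a : (eta < mdeg a)%N -> 'X_[a] \in J.
  move=> a_eta; apply/negPn/negP => aJ.
  have [b + soc_ab] := mulX_mem_socle JN aJ; move/negP; apply.
  rewrite -pi_eq0 (socE _ soc_ab); set c := w _.
  (* The monomial has degree above [eta], so the component of degree [eta] of this difference is
     [- c *: h], which therefore lies in [J]. *)
  have : 'X_[a] * 'X_[b] - c *: h \in J.
    by rewrite -pi_eq0 rmorphB /= pi_scale -(socE _ soc_ab) subrr.
  move=> /(homogeneous_ideal_pihomog eta Jhom); rewrite linearB linearZ /=.
  rewrite (pihomog_dE h_eta) -mpolyXD pihomogX /= mdegD gtn_eqF ?ltn_addr //.
  by rewrite sub0r rpredN -pi_eq0 pi_scale.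
have soc_eta f : f \is eta.-homog -> socle J (cl f).
  move=> /dhomogP f_eta; apply/mem_socle => i.
  rewrite [f]mpolyE mulr_suml big_seq rpred_sum // => a /f_eta /= a_eta.
  by rewrite -scalerAl -mpolyXD -mul_mpolyC idealMr // JX // mdegD mdeg1 a_eta addn1.
(* [w] is arbitrary outside the socle; [r] is its linear replacement, and it is
   well defined because J is homogeneous. *)
pose r (a : A) := w (cl (pihomog mdeg eta (repr a))).
have rE f : r (cl f) = w (cl (pihomog mdeg eta f)).
  congr w; apply/eqP; rewrite -Quotient.idealrBE -linearB /=.
  by apply: homogeneous_ideal_pihomog => //; rewrite Quotient.idealrBE reprK.
have r_lin : linear_for *%R r.
  move=> c a b; rewrite -[a]reprK -[b]reprK -pi_scale -rmorphD !rE linearP.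
  by rewrite rmorphD /= pi_scale wlin //; apply: soc_eta; apply: pihomogP.
pose rho := HB.pack_for {scalar A} r (GRing.isLinear.Build k A k *%R r r_lin).
(* Each coefficient of the power is the class of a form of degree [eta] (possibly zero), on which
   [r] agrees with [w]. *)
have -> : power_form J w eta = power_form J rho eta.
  apply/mpolyP => a; rewrite !mcoeff_power_form ?raddf0 //.
  set x := _@_a; have fact0 : (mfact a)%:R != 0 :> k.
    by rewrite ((pcharf0P k).1 k0) -lt0n prodn_gt0 // => i; apply: fact_gt0.
  have -> : x = cl (((mfact a)%:R)^-1 *: ('X_[a] *+ eta`! *+ (mdeg a == eta))).
    have clMn f d : cl (f *+ d) = cl f *+ d by exact: raddfMn.
    rewrite pi_scale !clMn pi_mpolyX -mcoeff_linear_formXn -/x.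
    by rewrite -scaler_nat scalerA mulVf // scale1r.
  rewrite /= rE pihomog_dE // dhomogZ //; case: eqP => [a_eta|_].
    by do 2!apply: rpredMn; rewrite dhomogX; apply/eqP.
  by rewrite mulr0n dhomog0.
apply: inverse_system_power_form => // [f j j_eta f_j | a soc_a].
  by rewrite /= rE (pihomog_ne0 _ f_j) ?rmorph0 // ltn_eqF.
rewrite /= (socE a soc_a) -pi_scale rE pihomog_dE ?dhomogZ // pi_scale whZ.
by move=> ->; rewrite scale0r.
Qed.

End SocleForm.

(** * Ideals maximal among those avoiding the powers of an element *)

Section IdealLemmas.
Variables (R : comNzRingType) (M : set R).
Hypothesis MI : is_ideal M.

Lemma is_idealD x y : M x -> M y -> M (x + y).
Proof. by case: MI => _ MD _; apply: MD. Qed.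

Lemma is_idealMl a x : M x -> M (a * x).
Proof. by case: MI => _ _; apply. Qed.

Lemma is_idealMr a x : M x -> M (x * a).
Proof. by rewrite mulrC; apply: is_idealMl. Qed.

Lemma is_idealB x y : M x -> M y -> M (x - y).
Proof.
by move=> Mx My; apply: is_idealD => //; rewrite -mulN1r; apply: is_idealMl.
Qed.

Lemma is_ideal_sum (T : Type) (r : seq T) (F : T -> R) :
  (forall t, M (F t)) -> M (\sum_(t <- r) F t).
Proof.
by move=> MF; elim/big_ind: _ => // [|x y]; [case: MI | apply: is_idealD].
Qed.

End IdealLemmas.

Lemma idealr_is_ideal (R : comNzRingType) (J : idealr R) : is_ideal [set` J].
Proof.
by split=> [|x y|a x] /=; [apply: idealr0 | apply: rpredD | apply: idealMr].
Qed.

(** Zorn's lemma; by maximality, adjoining [f] to [M] captures a power of [x]. As [x ^+ 0] is 1, [M]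
    is proper. *)
Lemma maximal_ideal_avoiding_powers (R : comNzRingType) (I : set R) (x : R) :
  is_ideal I -> (forall N, ~ I (x ^+ N)) ->
  exists M : set R, [/\ is_ideal M, I `<=` M, forall N, ~ M (x ^+ N) &
    forall f, ~ M f -> exists N g, M (x ^+ N - g * f)].
Proof.
move=> II Ix.
(* [set0] is allowed because it is the union of the empty chain. *)
pose good (M : set R) := [/\ is_ideal M, I `<=` M & forall N, ~ M (x ^+ N)].
have [F Ftot FF|M [[M0|Mgood] Mmax]] := @Zorn_bigcup R [set M | M = set0 \/ good M].
- have [[B [FB goodB]]|noB] := pselect (exists B, F B /\ good B); last first.
    left; rewrite -subset0 => y [B FB By].
    have [B0|goodB] := Ftot _ FB; first by rewrite B0 in By.
    by apply: noB; exists B.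
  right; have [[B0 BD BM] IB Bx] := goodB; split; first split.
  + by exists B.
  + move=> y z [Y FY Yy] [Z FZ Zz].
    have [Y0|[[_ YD _] _ _]] := Ftot _ FY; first by rewrite Y0 in Yy.
    have [Z0|[[_ ZD _] _ _]] := Ftot _ FZ; first by rewrite Z0 in Zz.
    have [YZ|ZY] := FF _ _ FY FZ; first by exists Z => //; apply: ZD => //; apply: YZ.
    by exists Y => //; apply: YD => //; apply: ZY.
  + move=> a y [Y FY Yy].
    have [Y0|[[_ _ YM] _ _]] := Ftot _ FY; first by rewrite Y0 in Yy.
    by exists Y => //; apply: YM.
  + by move=> y /IB By; exists B.
  + move=> N [Y FY Yx].
    have [Y0|[_ _ /(_ N)]] := Ftot _ FY; first by rewrite Y0 in Yx.
    by apply.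
- case: (Mmax I); last by right; split.
  rewrite M0; split; first exact: sub0set.
  by move=> /(_ 0); apply; case: II.
have [MI IM Mx] := Mgood; exists M; split=> // f Mf.
apply: contrapT => no_g; pose B := [set y | exists m g, M m /\ y = m + g * f].
have MB : M `<=` B by move=> m Mm; exists m, 0; rewrite mul0r addr0.
apply: (Mmax B); first split=> // [BM].
  by apply: Mf; apply: BM; exists 0, 1; rewrite add0r mul1r; case: MI.
right; split; first split.
- by apply: MB; case: MI.
- move=> _ _ [m [g [Mm ->]]] [m' [g' [Mm' ->]]].
  by exists (m + m'), (g + g'); split; [exact: is_idealD | rewrite mulrDl addrACA].
- move=> a _ [m [g [Mm ->]]].
  by exists (a * m), (a * g); split; [exact: is_idealMl | rewrite mulrDr mulrA].
- by move=> y /IM; apply: MB.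
move=> N [m [g [Mm xE]]]; apply: no_g; exists N, g.
by rewrite xE addrK.
Qed.

(* A form of uncountability: T is not a countable union of finite sets. *)
Definition infinite_fibers (T : eqType) := forall phi : T -> nat, exists d,
  forall N, exists s : seq T,
    [/\ uniq s, size s = N & forall c, c \in s -> phi c = d].

(** * The Nullstellensatz over an uncountable algebraically closed field *)

Section Nullstellensatz.
Variables (K : closedFieldType) (n : nat).
Hypothesis K_uncountable : infinite_fibers K.
Implicit Types (M I : set {mpoly K[n]}) (x : {mpoly K[n]}).

(** [N] exceeds by one the number of monomials of degree below [D], so the rows of the coefficient
    matrix are dependent. *)
Lemma mpoly_dependent (D : nat) : exists N, forall g : 'I_N -> {mpoly K[n]},
  (forall r, (msize (g r) <= D)%N) ->
  exists2 v : 'I_N -> K, (exists r, v r != 0) & \sum_r v r *: g r = 0.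
Proof.
exists #|{: 'X_{1..n < D}}|.+1 => g gD.
pose B : 'M_(_, #|{: 'X_{1..n < D}}|) :=
  \matrix_(r, m) (g r)@_(enum_val m : 'X_{1..n < D}).
have : kermx B != 0.
  by rewrite kermx_eq0 /row_free ltn_eqF // ltnS rank_leq_col.
move=> /rowV0Pn[v /sub_kermxP vB v0]; exists (v 0).
  by have /rV0Pn := v0.
apply/mpolyP => m; rewrite mcoeff0 raddf_sum /=.
have [mD | Dm] := ltnP (mdeg m) D; last first.
  rewrite big1 // => r _; rewrite mcoeffZ memN_msupp_eq0 ?mulr0 //.
  exact: msize_mdeg_ge (leq_trans (gD r) Dm).
have /rowP/(_ (enum_rank (BMultinom mD))) := vB.
rewrite !mxE => vBm; rewrite -[RHS]vBm; apply: eq_bigr => r _.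
by rewrite mcoeffZ mxE enum_rankK.
Qed.

(** If [a] and [b] were outside [M], two powers of [x] would be multiples of them modulo [M], and
    the product of these powers would lie in [M]. *)
Lemma avoiding_powers_prime M x : is_ideal M -> (forall N, ~ M (x ^+ N)) ->
  (forall f, ~ M f -> exists N g, M (x ^+ N - g * f)) ->
  forall a b, M (a * b) -> M a \/ M b.
Proof.
move=> MI Mx Mmax a b Mab; apply: contrapT => /not_orP[Ma Mb].
have [N [g Mg]] := Mmax a Ma; have [N' [h Mh]] := Mmax b Mb.
apply: (Mx (N + N')%N); rewrite exprD.
have -> : x ^+ N * x ^+ N' =
    (x ^+ N - g * a) * x ^+ N' + (g * a) * (x ^+ N' - h * b) + g * h * (a * b).
  by rewrite mulrBl mulrBr addrA addrNK mulrACA addrNK.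
by do !apply: is_idealD => //; [apply: is_idealMr|apply: is_idealMl|apply: is_idealMl].
Qed.

Lemma avoiding_powers_residue M x (j : 'I_n) : is_ideal M ->
  (forall N, ~ M (x ^+ N)) ->
  (forall f, ~ M f -> exists N g, M (x ^+ N - g * f)) ->
  exists c, M ('X_j - c%:MP).
Proof.
move=> MI Mx Mmax; have Mprime := avoiding_powers_prime MI Mx Mmax.
apply: contrapT => noc.
have /choice[Ng NgP] : forall c, exists Ng : nat * {mpoly K[n]},
    M (x ^+ Ng.1 - Ng.2 * ('X_j - c%:MP)).
  move=> c; have [|N [g ?]] := Mmax ('X_j - c%:MP); last by exists (N, g).
  by move=> Mc; apply: noc; exists c.
(* [pickle] packs exponent and size into one number, so that a fiber fixes both. *)
have [d dP] := K_uncountable (fun c => pickle ((Ng c).1, msize (Ng c).2)).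
have [c0 c0d] : exists c0, pickle ((Ng c0).1, msize (Ng c0).2) = d.
  have [[|c0 s0] [_ // _ s0d]] := dP 1%N.
  by exists c0; apply: s0d; apply: mem_head.
have [N depN] := mpoly_dependent (msize (Ng c0).2).
have [s [us sN sd]] := dP N.
pose c (r : 'I_N) := s`_r.
have cs r : c r \in s by rewrite mem_nth // sN.
have cE r : (Ng (c r)).1 = (Ng c0).1 /\ msize (Ng (c r)).2 = msize (Ng c0).2.
  by have := sd _ (cs r); rewrite -c0d => /(pcan_inj pickleK)[].
have c_inj : injective c.
  by move=> r r' /eqP; rewrite nth_uniq ?sN // => /eqP/val_inj.
have [r|v [r0 vr0] v_dep] := depN (fun r => (Ng (c r)).2); first by rewrite (cE r).2.
(* [h] interpolates the values v_r, up to the nonzero factors Lag_r(c_r). *)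
pose Lag r := \prod_(r' | r' != r) ('X - (c r')%:P).
pose h := \sum_r v r *: Lag r.
have h0 : h != 0.
  apply: contraNneq vr0 => /(congr1 (horner^~ (c r0))).
  rewrite horner0 horner_sum (bigD1 r0) //= big1 => [|r rr0]; last first.
    by rewrite hornerZ horner_prod (bigD1 r0) 1?eq_sym //= hornerXsubC subrr mul0r mulr0.
  rewrite addr0 hornerZ => /eqP; rewrite mulf_eq0 => /orP[//|].
  rewrite horner_prod => /prodf_eq0[r rr0].
  by rewrite hornerXsubC subr_eq0 (inj_eq c_inj) eq_sym (negbTE rr0).
pose ev := GRing.LRMorphism.clone _ {poly K} {mpoly K[n]} _ (horner_alg 'X_j) _.
have evXc (z : K) : ev ('X - z%:P) = 'X_j - z%:MP.
  by rewrite rmorphB /= horner_algX horner_algC alg_mpolyC.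
have evZ (a : K) p : ev (a *: p) = a *: ev p
  by rewrite -mul_polyC rmorphM /= horner_algC alg_mpolyC mul_mpolyC.
have evh : ev h = \sum_r v r *: ev (Lag r).
  by rewrite rmorph_sum; apply: eq_bigr => r _; apply: evZ.
(* Multiply the relation between the cofactors by the product [L] of all factors and replace each
   cofactor times its factor by the common power of [x]. Primality then removes that power. *)
have Mh : M (ev h).
  have [//|/Mx//] : M (ev h) \/ M (x ^+ (Ng c0).1).
  apply: Mprime; rewrite mulrC.
  have -> : x ^+ (Ng c0).1 * ev h = \sum_r v r *: ev (Lag r) *
      (x ^+ (Ng (c r)).1 - (Ng (c r)).2 * ('X_j - (c r)%:MP)).
    pose L := \prod_r ('X - (c r)%:P).
    have LE r : ev (Lag r) * ('X_j - (c r)%:MP) = ev L.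
      by rewrite -evXc -rmorphM /L (bigD1 r) //= mulrC.
    have vL : \sum_r v r *: (Ng (c r)).2 * ev L = 0 by rewrite -mulr_suml v_dep mul0r.
    rewrite -[LHS]subr0 -{}[in LHS]vL evh mulr_sumr -sumrB.
    apply: eq_bigr => r _; rewrite (cE r).1 mulrBr -!scalerAl -scalerAr.
    by rewrite [x ^+ _ * _]mulrC mulrCA LE.
  by apply: is_ideal_sum => // r; apply: is_idealMl.
have [zs hE] := closed_field_poly_normal h.
have : M (ev (\prod_(z <- zs) ('X - z%:P))).
  have -> : \prod_(z <- zs) ('X - z%:P) = (lead_coef h)^-1 *: h.
    by rewrite {2}hE scalerA mulVf ?scale1r // lead_coef_eq0.
  by rewrite evZ -mul_mpolyC; apply: is_idealMl.
elim: zs {hE} => [|z zs IHzs]; first by rewrite big_nil rmorph1 -(expr0 x) => /Mx.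
rewrite big_cons rmorphM /= => /Mprime[|//].
by rewrite evXc => Mz; apply: noc; exists z.
Qed.

(** The residues of the variables modulo [M] are the coordinates of [z], so each polynomial is
    congruent to its value at [z]; constants in [M] vanish, and ['X_i] is not in [M]. *)
Lemma nullstellensatz I (i : 'I_n) :
  is_ideal I -> (forall N, ~ I ('X_i ^+ N)) ->
  exists2 z : 'I_n -> K, z i != 0 & forall f, I f -> f.@[z] = 0.
Proof.
move=> II Ii; have [M [MI IM Mx Mmax]] := maximal_ideal_avoiding_powers II Ii.
have /choice[z Mz] j := avoiding_powers_residue j MI Mx Mmax.
have Mconst c : M c%:MP -> c = 0.
  move=> Mc; apply: contrapT => /eqP c0; apply: (Mx 0%N).
  by rewrite expr0 -mpolyC1 -(mulVf c0) mpolyCM; apply: is_idealMl.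
pose T f := M (f - f.@[z]%:MP).
have TM f g : T f -> T g -> T (f * g).
  rewrite /T mevalM mpolyCM => Tf Tg.
  have -> : f * g - f.@[z]%:MP * g.@[z]%:MP =
    (f - f.@[z]%:MP) * g + f.@[z]%:MP * (g - g.@[z]%:MP).
    by rewrite mulrBl mulrBr addrA addrNK.
  by apply: is_idealD => //; [apply: is_idealMr | apply: is_idealMl].
have M0 : M 0 by case: MI.
have TC c : T c%:MP by rewrite /T mevalC subrr.
have TX j : T 'X_j by rewrite /T mevalXU; apply: Mz.
have T_all f : T f.
  rewrite [f]mpolyE; elim/big_ind: _ => [|f1 f2 T1 T2|m _].
  - by rewrite -mpolyC0; apply: TC.
  - by rewrite /T mevalD mpolyCD opprD addrACA; apply: is_idealD.
  rewrite -mul_mpolyC; apply: (TM) => //; rewrite mpolyXE_id.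
  elim/big_ind: _ => [|f1 f2|j _]; [by rewrite -mpolyC1; apply: TC | exact: TM |].
  by elim: (m j) => [|d IHd]; [rewrite expr0 -mpolyC1; apply: TC | rewrite exprS; apply: TM].
exists z => [|f /IM Mf].
  apply/eqP => zi; apply: (Mx 1%N); rewrite expr1 -['X_i]subr0 -mpolyC0 -zi.
  exact: Mz.
by apply: Mconst; rewrite -[_%:MP](subKr f); apply: is_idealB => //; apply: T_all.
Qed.

End Nullstellensatz.

(** * Uncountability of the real and complex numbers *)

Lemma infinite_fibers_real (R : realType) : infinite_fibers R.
Proof.
move=> phi; apply: contrapT => /forallNP fin_fiber.
(* Nested intervals: of N disjoint subintervals of [p.1, p.2], where N bounds the
   size of the fiber of d, one misses this fiber. *)
have step d (p : R * R) : exists q : R * R, p.1 < p.2 ->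
    [/\ p.1 <= q.1, q.1 < q.2, q.2 <= p.2 &
        forall x, q.1 <= x <= q.2 -> phi x <> d].
  case: p => a b; have [ab|ba] := ltP a b; last by exists (0, 0).
  have /existsNP[N noN] := fin_fiber d.
  apply: contrapT => /forallNP no_q; apply: noN.
  (* Every other one of the [2 * N.+1] equal pieces is used, so the closed intervals are disjoint;
     [N.+1] keeps the divisor nonzero when [N] is 0. *)
  pose e := (b - a) / (2 * N.+1)%:R.
  have e0 : 0 < e by rewrite divr_gt0 ?subr_gt0 // ltr0n.
  have /choice[x xP] (i : 'I_N) : exists x,
      a + (2 * i)%:R * e <= x <= a + (2 * i).+1%:R * e /\ phi x = d.
    apply: contrapT => /forallNP no_x.
    apply: (no_q (a + (2 * i)%:R * e, a + (2 * i).+1%:R * e)) => _; split => /=.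
    - by rewrite lerDl mulr_ge0 ?ler0n // ltW.
    - by rewrite ltrD2l ltr_pM2r // ltr_nat.
    - rewrite -lerBrDl -[leRHS](@divfK _ (2 * N.+1)%:R) ?pnatr_eq0 // -/e mulrC.
      by rewrite ler_pM2l // ler_nat mulnS; have := ltn_ord i; lia.
    - by move=> x xi xd; apply: (no_x x).
  have x_mono (i j : 'I_N) : (i < j)%N -> x i < x j.
    move=> ij; have [/andP[_ xi] _] := xP i; have [/andP[xj _] _] := xP j.
    apply: le_lt_trans xi (lt_le_trans _ xj).
    by rewrite ltrD2l ltr_pM2r // ltr_nat; lia.
  exists [seq x i | i <- enum 'I_N]; split; last 2 first.
  - by rewrite size_map size_enum_ord.
  - by move=> _ /mapP[i _ ->]; have [] := xP i.
  rewrite map_inj_uniq ?enum_uniq // => i j xij; apply/val_inj.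
  by have [/x_mono|/x_mono|] := ltngtP i j; rewrite // xij ltxx.
have /choice[F FP] d : exists F : R * R -> R * R, forall p, p.1 < p.2 ->
    [/\ p.1 <= (F p).1, (F p).1 < (F p).2, (F p).2 <= p.2 &
        forall x, (F p).1 <= x <= (F p).2 -> phi x <> d].
  by have [G GP] := choice (step d); exists G.
pose I := fix I d := if d is d'.+1 then F d' (I d') else (0, 1) : R * R.
have Ilt d : (I d).1 < (I d).2.
  by elim: d => [|d Id]; [exact: ltr01 | have [] := FP d _ Id].
have Imono d d' : (d <= d')%N -> (I d).1 <= (I d').1 /\ (I d').2 <= (I d).2.
  elim: d' => [|d' IHd]; first by rewrite leqn0 => /eqP->.
  rewrite leq_eqVlt ltnS => /predU1P[->//|/IHd[l1 l2]].
  have [F1 _ F2 _] := FP d' _ (Ilt d').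
  by split; [apply: le_trans l1 F1 | apply: le_trans F2 l2].
have Iub d d' : (I d).1 <= (I d').2.
  have [d1 _] := Imono _ _ (leq_maxl d d').
  have [_ d2] := Imono _ _ (leq_maxr d d').
  exact: le_trans d1 (le_trans (ltW (Ilt _)) d2).
pose E := range (fun d => (I d).1).
have E_sup : has_sup E.
  split; first by exists (I 0%N).1, 0%N.
  by exists (I 0%N).2 => _ [d _ <-].
pose d := phi (sup E).
(* The supremum lies in the interval of index [d.+1], which was chosen to miss the fiber of [d]. *)
have [_ _ _ /(_ (sup E))] := FP d _ (Ilt d); apply => //.
apply/andP; split.
  by apply: ub_le_sup; [case: E_sup | exists d.+1].
by apply: ge_sup; [case: E_sup | move=> _ [d' _ <-]; apply: (Iub d' d.+1)].
Qed.

Lemma infinite_fibers_complex (R : realType) : infinite_fibers R[i].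
Proof.
move=> phi; have [d dP] := infinite_fibers_real (fun x => phi x%:C%C).
exists d => N; have [s [us sN sd]] := dP N.
exists [seq x%:C%C | x <- s]; rewrite size_map map_inj_uniq; last first.
  by move=> x y [].
by split=> // _ /mapP[x xs ->]; apply: sd.
Qed.

Theorem corollary3p3 :
  (forall (k : fieldType) (n : nat) (J : idealr {mpoly k[n]}) (eta : nat)
      (rho : {scalar {ideal_quot J}}),
    [pchar k] =i pred0 ->
    homogeneous_ideal [set` J] ->
    [set` J] `<=` gen_ideal (range (fun i : 'I_n => 'X_i : {mpoly k[n]})) ->
    artinian {ideal_quot J} ->
    gorenstein J ->
    socle_degree J eta ->
    complementary [set a | rho a = 0] (socle J) ->
    [set a | rho a = 0] = sum_pieces J eta ->
    inverse_system J (power_form J rho eta))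
  /\
  (forall (R : realType) (n m : nat) (Delta : {mpoly R[i][n]} -> R[i])
      (Q : {mpoly R[i][n]}),
    (2 <= n)%N ->
    forall m_ge3 : (3 <= m)%N,
    is_discriminant m Delta ->
    forall QX : nondegenerate_form m Delta Q,
    let JQ := milnor_ideal m_ge3 (proj1 QX) in
    forall omega : {ideal_quot JQ} -> R[i],
    socle_iso JQ omega ->
    omega (\pi_{ideal_quot JQ} (hessian Q)) = 1 ->
    inverse_system JQ (power_form JQ omega (n * (m - 2)))).
Proof.
split=> [k n J eta rho k0 _ _ _ _ | R n m Delta Q _ m_ge3 discr QX JQ w w_iso wh].
  exact: inverse_system_socle_degree.
have Qm := QX.1.
have JQE : [set` JQ] = gradient_ideal Q.
  by apply/predeqP => f; split=> [/asboolP | fJ] //; apply/asboolP.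
have dQ_J j : Q^`M(j) \in JQ.
  have : gradient_ideal Q Q^`M(j); last by rewrite -JQE.
  by exists 1%N, (fun=> 1), (fun=> Q^`M(j)); split=> [_|];
    [exists j | rewrite big_ord1 mul1r].
apply: (inverse_system_socle_iso _ _ _ w_iso (dhomog_hessian Qm) _ wh).
- exact: pchar_num.
- exists (range (fun j => Q^`M(j))); last exact: JQE.
  by move=> _ [j _ <-]; exists m.-1; apply: dhomog_mderiv.
(* Otherwise the partial derivatives would have a common zero with nonzero [i]-th coordinate,
   against the discriminant condition. *)
- move=> i; apply: contrapT => /forallNP JXi.
  have [z zi zJ] := nullstellensatz (@infinite_fibers_complex R) (idealr_is_ideal JQ) JXi.
  have /discr := Qm; case=> /(_ QX.2) + _; apply; exists z; first by exists i.
  by move=> j; apply: zJ; apply: dQ_J.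
apply/mem_socle => j; move: Qm; rewrite -(ltn_predK m_ge3) => Qm'.
rewrite (hessian_mulX j Qm') rpredMn // rpred_sum // => i _.
by rewrite idealMr.
Qed.
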